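(* Let $\Lambda\subseteq\mathcal{L}$ be a normal propositionally quantified modal logic containing all instances of the Barcan scheme $\Diamond\exists p\,\varphi\to\exists p\,\Diamond\varphi$ (i.e. $\Lambda\supseteq\mathsf{K}_\Pi\mathtt{Bc}$). Then $\Lambda$ is strongly complete with respect to the class of quantifiable frames validating $\Lambda$: every $\Lambda$-consistent set $\Gamma\subseteq\mathcal{L}$ is satisfiable on such a frame, i.e. there are a quantifiable frame $\mathbf{F}=(W,R,B)$ on which every formula of $\Lambda$ is valid, a valuation $v:\mathsf{Prop}\to B$ and a world $w\in W$ such that $w\in[\![\varphi]\!]^{\mathbf{F}}(v)$ for all $\varphi\in\Gamma$.
   Context: Language. Fix a countably infinite (enumerated) set $\mathsf{Prop}$ of propositional variables. $\mathcal{L}$ is given by $\varphi::=p\mid\neg\varphi\mid(\varphi\vee\varphi)\mid\Diamond\varphi\mid\exists p\,\varphi$ with $p\in\mathsf{Prop}$; $\wedge,\to,\leftrightarrow,\Box,\forall p$ are the usual abbreviations. $\mathsf{Fv}(\varphi)$ is the set of free variables of $\varphi$. Semantics. A Kripke frame is a pair $(W,R)$ with $W\neq\varnothing$, $R\subseteq W^2$. A general frame is $\mathbf{F}=(W,R,B)$ where $(W,R)$ is a Kripke frame and $B\subseteq\wp(W)$ is non-empty and closed under Boolean operations and $m_\Diamond(X)=\{w\in W\mid\exists u\in X,\ wRu\}$. A valuation is $v:\mathsf{Prop}\to B$. Semantic values: $[\![p]\!]^{\mathbf F}(v)=v(p)$, $[\![\neg\varphi]\!]^{\mathbf F}(v)=W\setminus[\![\varphi]\!]^{\mathbf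 F}(v)$, $[\![\varphi\vee\psi]\!]^{\mathbf F}(v)=[\![\varphi]\!]^{\mathbf F}(v)\cup[\![\psi]\!]^{\mathbf F}(v)$, $[\![\Diamond\varphi]\!]^{\mathbf F}(v)=m_\Diamond([\![\varphi]\!]^{\mathbf F}(v))$, $[\![\exists p\,\varphi]\!]^{\mathbf F}(v)=\bigcup\{[\![\varphi]\!]^{\mathbf F}(v[X/p])\mid X\in B\}$, where $v[X/p]$ agrees with $v$ except that it sends $p$ to $X$. $\varphi$ is valid on $\mathbf F$ if $[\![\varphi]\!]^{\mathbf F}(v)=W$ for all valuations $v$. A quantifiable frame is a general frame with $[\![\varphi]\!]^{\mathbf F}(v)\in B$ for all $\varphi\in\mathcal{L}$ and all valuations $v$. Substitutions. A substitution is a function $\sigma:\mathsf{Prop}\to\mathcal{L}$; $\sigma_p^\psi$ agrees with $\sigma$ except that it sends $p$ to $\psi$. It extends to $\mathcal{L}$ by commuting with $\neg,\vee,\Diamond$ and $\sigma(\exists p\,\varphi)=\exists q\,\sigma_p^q(\varphi)$, where $q=p$ if $p\notin\bigcup_{r\in\mathsf{Fv}(\exists p\varphi)}\mathsf{Fv}(\sigma(r))$ and otherwise $q$ is the first variable not used in $\exists p\,\varphi$ nor in any $\sigma(r)$ for $r\in\mathsf{Fv}(\exists p\,\varphi)$. $\iota$ is the identity substitution. Logics. A normal propositionally quantified modal logic (NPQML) is a set $\Lambda\subseteq\mathcal{L}$ such that: all propositional tautologies are in $\Lambda$; $\Box(p\to q)\to(\Box p\to\Box q)$ and $\Diamond p\leftrightarrow\neg\Box\neg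 p$ are in $\Lambda$; all instances of $\iota_p^\psi(\varphi)\to\exists p\,\varphi$ are in $\Lambda$; if $\varphi\in\Lambda$ then $\Box\varphi\in\Lambda$; if $\varphi,\varphi\to\psi\in\Lambda$ then $\psi\in\Lambda$; if $\varphi\to\psi\in\Lambda$ and $p\notin\mathsf{Fv}(\psi)$ then $\exists p\,\varphi\to\psi\in\Lambda$. $\mathsf{K}_\Pi\mathtt{Bc}$ is the smallest NPQML containing all instances of the Barcan scheme. A set $\Gamma\subseteq\mathcal{L}$ is $\Lambda$-consistent if there is no finite $A\subseteq\Gamma$ with $\neg(\bigwedge A)\in\Lambda$. *)

(* Defs.v *)
From HB Require Import structures.
From mathcomp Require Import all_boot.
From mathcomp Require Import boolp classical_sets.

Set Implicit Arguments.
Unset Strict Implicit.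
Unset Printing Implicit Defensive.

Local Open Scope classical_set_scope.

(* The enumerated set of propositional variables is nat with its usual order,
   so the first variable with a property is the least such number. *)
Definition pvar := nat.

Inductive form : Type :=
| Var of pvar
| Neg of form
| Or of form & form
| Dia of form
| Ex of pvar & form.

HB.instance Definition _ := gen_eqMixin form.

Definition And (a b : form) : form := Neg (Or (Neg a) (Neg b)).
Definition Imp (a b : form) : form := Or (Neg a) b.
Definition Iff (a b : form) : form := And (Imp a b) (Imp b a).
Definition Box (a : form) : form := Neg (Dia (Neg a)).
Definition Top : form := Or (Var 0) (Neg (Var 0)).

Definition bigAnd (A : seq form) : form := foldr And Top A.

Fixpoint fv (a : form) : seq pvar :=
  match a with
  | Var p => [:: p]
  | Neg b => fv b
  | Or b c => fv b ++ fv c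
  | Dia b => fv b
  | Ex p b => [seq r <- fv b | r != p]
  end.

(* All variables used in a formula, whether free, bound, or only in a
   quantifier prefix. *)
Fixpoint vars (a : form) : seq pvar :=
  match a with
  | Var p => [:: p]
  | Neg b => vars b
  | Or b c => vars b ++ vars c
  | Dia b => vars b
  | Ex p b => p :: vars b
  end.

Lemma exists_fresh (s : seq pvar) : exists n : pvar, n \notin s.
Proof.
exists (\max_(i <- s) i).+1; apply/negP => h.
by have := @leq_bigmax_seq _ _ xpredT (fun i : nat => i) _ h isT; rewrite ltnn.
Qed.

Definition first_fresh (s : seq pvar) : pvar := ex_minn (exists_fresh s).

Definition subst_binder (s : pvar -> form) (p : pvar) (a : form) : pvar :=
  let free := fv (Ex p a) in
  if p \notin flatten [seq fv (s r) | r <- free] then p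
  else first_fresh (vars (Ex p a) ++ flatten [seq vars (s r) | r <- free]).

Fixpoint subst (s : pvar -> form) (a : form) : form :=
  match a with
  | Var p => s p
  | Neg b => Neg (subst s b)
  | Or b c => Or (subst s b) (subst s c)
  | Dia b => Dia (subst s b)
  | Ex p b => let q := subst_binder s p b in
              Ex q (subst [eta s with p |-> Var q] b)
  end.

Definition m_dia (W : Type) (R : W -> W -> Prop) (X : set W) : set W :=
  [set w | exists2 u, X u & R w u].

Record general_frame : Type := GeneralFrame {
  world : Type;
  acc : world -> world -> Prop;
  adm : set (set world);
  world_inhabited : inhabited world;
  adm_nonempty : adm !=set0;
  adm_setC : forall X, adm X -> adm (~` X);
  adm_setU : forall X Y, adm X -> adm Y -> adm (X `|` Y);
  adm_dia : forall X, adm X -> adm (m_dia acc X)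
}.

Arguments acc : clear implicits.
Arguments adm : clear implicits.

(* Valuations are functions into the powerset of the worlds, with values in
   the admissible sets as a separate condition. *)
Definition valuation (F : general_frame) (v : pvar -> set (world F)) : Prop :=
  forall p, adm F (v p).

Fixpoint sem (F : general_frame) (v : pvar -> set (world F)) (a : form)
    : set (world F) :=
  match a with
  | Var p => v p
  | Neg b => ~` sem v b
  | Or b c => sem v b `|` sem v c
  | Dia b => m_dia (acc F) (sem v b)
  | Ex p b => \bigcup_(X in adm F) sem [eta v with p |-> X] b
  end.

Definition valid (F : general_frame) (a : form) : Prop :=
  forall v : pvar -> set (world F), valuation v -> sem v a = setT.

Definition quantifiable (F : general_frame) : Prop :=
  forall (a : form) (v : pvar -> set (world F)),
    valuation v -> adm F (sem v a).

(* Truth-functional validity, where variables and formulas of the forms Dia b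
   and Ex p b are treated as atoms. *)
Definition tautology (a : form) : Prop :=
  forall h : form -> bool,
    (forall b, h (Neg b) = ~~ h b) ->
    (forall b c, h (Or b c) = h b || h c) ->
    h a.

Record NPQML (L : set form) : Prop := {
  npqml_taut : forall a, tautology a -> L a;
  npqml_K : forall p q : pvar,
    L (Imp (Box (Imp (Var p) (Var q))) (Imp (Box (Var p)) (Box (Var q))));
  npqml_dual : forall p : pvar, L (Iff (Dia (Var p)) (Neg (Box (Neg (Var p)))));
  npqml_inst : forall (p : pvar) (a b : form),
    L (Imp (subst [eta Var with p |-> b] a) (Ex p a));
  npqml_nec : forall a, L a -> L (Box a);
  npqml_mp : forall a b, L a -> L (Imp a b) -> L b;
  npqml_ex : forall (p : pvar) (a b : form),
    L (Imp a b) -> p \notin fv b -> L (Imp (Ex p a) b)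
}.

Definition barcan (p : pvar) (a : form) : form :=
  Imp (Dia (Ex p a)) (Ex p (Dia a)).

(* Finite subsets are listed by sequences; the order and repetitions do not
   matter, as L is meant to contain the tautologies and be closed under
   modus ponens. *)
Definition consistent (L G : set form) : Prop :=
  ~ exists A : seq form, [set` A] `<=` G /\ L (Neg (bigAnd A)).

(* Main.v *)
Require Import Defs.
From mathcomp Require Import all_boot.
From mathcomp Require Import boolp classical_sets.

(* The worlds of the canonical frame are the maximal consistent sets with
   witnesses, its admissible sets those defined by a formula.  A valuation into
   these sets amounts to a substitution, so the truth lemma gives at once that
   the frame is quantifiable and, as the logic is closed under substitution,
   that it validates the logic.  When a successor is built inside [Dia], the
   Barcan scheme turns [Dia (Ex q b)] into [Ex q (Dia b)], whose witness in the
   given world is a witness for the successor.  Hence only the initial set needs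
   fresh variables, which are gained by renaming its free variables to even
   ones; the valuation undoes the renaming. *)

Set Implicit Arguments.
Unset Strict Implicit.
Unset Printing Implicit Defensive.

Local Open Scope classical_set_scope.

(** * Tautology checking and an enumeration of the formulas *)

Ltac taut :=
  let h := fresh "h" in let hN := fresh "hN" in let hO := fresh "hO" in
  move=> h hN hO; rewrite /Iff /Imp /And ?(hN, hO);
  repeat match goal with |- context [h ?a] => case: (h a) => //= end; by [].

(** The Lindenbaum construction decides formulas one after another. Coding them as finite trees
    labelled by numbers makes them countable. *)
Lemma ex_form_enumeration : exists e : nat -> form, forall a, exists n, e n = a.
Proof.
pose fix code (a : form) : GenTree.tree nat := match a with
  | Var p => GenTree.Leaf p
  | Neg b => GenTree.Node 0 [:: code b]
  | Or b c => GenTree.Node 1 [:: code b; code c]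
  | Dia b => GenTree.Node 2 [:: code b]
  | Ex p b => GenTree.Node 3 [:: GenTree.Leaf p; code b]
  end.
pose fix decode (t : GenTree.tree nat) : form := match t with
  | GenTree.Leaf p => Var p
  | GenTree.Node 0 [:: b] => Neg (decode b)
  | GenTree.Node 1 [:: b; c] => Or (decode b) (decode c)
  | GenTree.Node 2 [:: b] => Dia (decode b)
  | GenTree.Node 3 [:: GenTree.Leaf p; b] => Ex p (decode b)
  | _ => Top
  end.
have codeK : cancel code decode by elim=> //= [b ->|b -> c ->|b ->|p b ->].
exists (fun n => if unpickle n is Some t then decode t else Top) => a.
by exists (pickle (code a)); rewrite pickleK codeK.
Qed.

(** * Free variables and capture-avoiding substitution *)

Lemma fv_sub_vars (a : form) : {subset fv a <= vars a}.
Proof.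
elim: a => [p|b ih|b ihb c ihc|b ih|p b ih] x //=; try exact: ih.
  by rewrite !mem_cat => /orP[/ihb->|/ihc->]; rewrite ?orbT.
by rewrite mem_filter inE => /andP[_ /ih->]; rewrite orbT.
Qed.

Lemma first_freshP (s : seq pvar) : first_fresh s \notin s.
Proof. by rewrite /first_fresh; case: ex_minnP. Qed.

(** Absence of capture: [p] is kept only if it is free in none of the substituted formulas, and
    otherwise the new variable avoids all variables used in them, hence the free ones. *)
Lemma subst_binder_fresh (s : pvar -> form) (p : pvar) (a : form) (r : pvar) :
  r \in fv (Ex p a) -> subst_binder s p a \notin fv (s r).
Proof.
move=> rF; rewrite /subst_binder; case: ifP => h.
  by apply: contraNN h => h; apply/flatten_mapP; exists r.
set l := _ ++ _; apply/negP => /fv_sub_vars rS.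
have /negP := first_freshP l; apply.
by rewrite mem_cat; apply/orP; right; apply/flatten_mapP; exists r.
Qed.

(** The choice of the bound variable consults the substitution at free variables only, so the two
    results are equal as formulas, with no renaming. *)
Lemma eq_subst (a : form) (s t : pvar -> form) :
  (forall r, r \in fv a -> s r = t r) -> subst s a = subst t a.
Proof.
elim: a s t => [p|b ih|b ihb c ihc|b ih|p b ih] s t h /=.
- by apply: h; rewrite inE.
- by rewrite (ih s t).
- by rewrite (ihb s t) ?(ihc s t) // => r hr; apply: h;
  rewrite mem_cat hr ?orbT.
- by rewrite (ih s t).
have -> : subst_binder s p b = subst_binder t p b.
  rewrite /subst_binder.
  have e (f : form -> seq pvar) :
      [seq f (s r) | r <- fv (Ex p b)] = [seq f (t r) | r <- fv (Ex p b)].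
    by apply/eq_in_map => r /h ->.
  by rewrite !e.
congr Ex; apply: ih => r hr /=; case: eqP => // /eqP rp.
by apply: h; rewrite /= mem_filter rp.
Qed.

Lemma subst_Var (a : form) : subst Var a = a.
Proof.
elim: a => //= [b ->|b -> c ->|b ->|p b ih] //.
have -> : subst_binder Var p b = p.
  rewrite /subst_binder; case: ifP => // /negbFE /flatten_mapP[r].
  rewrite mem_filter => /andP[rp _]; rewrite inE => /eqP pr.
  by rewrite pr eqxx in rp.
by congr Ex; rewrite -[RHS]ih; apply: eq_subst => r _ /=; case: eqP => // ->.
Qed.

Lemma subst_id (a : form) (s : pvar -> form) :
  (forall r, r \in fv a -> s r = Var r) -> subst s a = a.
Proof. by move=> h; rewrite -[RHS]subst_Var; apply: eq_subst. Qed.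

Lemma subst1_fresh (p : pvar) (b a : form) :
  p \notin fv a -> subst [eta Var with p |-> b] a = a.
Proof.
move=> pa; apply: subst_id => r ra /=.
by case: eqP => // rp; rewrite -rp ra in pa.
Qed.

Lemma subst1_self (p : pvar) (a : form) :
  subst [eta Var with p |-> Var p] a = a.
Proof. by apply: subst_id => r _ /=; case: eqP => // ->. Qed.

Lemma fv_substP (a : form) (s : pvar -> form) (x : pvar) :
  x \in fv (subst s a) <-> exists2 r, r \in fv a & x \in fv (s r).
Proof.
elim: a s => [p|b ih|b ihb c ihc|b ih|p b ih] s /=; [|exact: ih| |exact: ih|].
- split=> [h|[r]]; first by exists p; rewrite ?inE.
  by rewrite inE => /eqP->.
- rewrite mem_cat; split=> [/orP[/ihb|/ihc][r h1 h2]|[r]].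
  + by exists r; rewrite // mem_cat h1.
  + by exists r; rewrite // mem_cat h1 orbT.
  + rewrite mem_cat => /orP[h1|h1] h2; apply/orP; [left|right].
      by apply/ihb; exists r.
    by apply/ihc; exists r.
rewrite mem_filter; set q := subst_binder s p b.
split=> [/andP[xq /ih[r rb /=]]|[r rF xr]].
  case: eqP => [_|/eqP rp xr]; first by rewrite inE (negPf xq).
  by exists r; rewrite // mem_filter rp.
have qF := subst_binder_fresh s rF.
move: (rF); rewrite mem_filter => /andP[rp rb].
apply/andP; split; first by apply: contraNneq qF; rewrite -/q => <-.
by apply/ih; exists r => //=; rewrite (negPf rp).
Qed.

(** * Derived rules of the logic, up to closure under substitution *)

Section Logic.
Context (L : set form) (hL : NPQML L).

Lemma taut_mp a b : L a -> tautology (Imp a b) -> L b.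
Proof. by move=> ha /(npqml_taut hL); apply: npqml_mp. Qed.

Lemma taut_mp2 a b c : L a -> L b -> tautology (Imp a (Imp b c)) -> L c.
Proof. by move=> ha hb /(taut_mp ha); apply: npqml_mp. Qed.

Lemma taut_mp3 a b c d :
  L a -> L b -> L c -> tautology (Imp a (Imp b (Imp c d))) -> L d.
Proof. by move=> ha hb hc /(taut_mp2 ha hb); apply: npqml_mp. Qed.

Lemma taut_mp4 a b c d e :
  L a -> L b -> L c -> L d -> tautology (Imp a (Imp b (Imp c (Imp d e)))) ->
  L e.
Proof. by move=> ha hb hc hd /(taut_mp3 ha hb hc); apply: npqml_mp. Qed.

Lemma iff_impl a b : L (Iff a b) -> L (Imp a b).
Proof. by move=> h; apply: taut_mp h _; taut. Qed.

Lemma iff_impr a b : L (Iff a b) -> L (Imp b a).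
Proof. by move=> h; apply: taut_mp h _; taut. Qed.

Lemma iff_intro a b : L (Imp a b) -> L (Imp b a) -> L (Iff a b).
Proof. by move=> h1 h2; apply: taut_mp2 h1 h2 _; taut. Qed.

(** A theorem [a] refutes [Ex p (Neg a)], and the instance axiom for [Neg a] then refutes every
    instance of [Neg a]. *)
Lemma subst1_closed p b a : L a -> L (subst [eta Var with p |-> b] a).
Proof.
move=> ha; have [q] := exists_fresh [:: p].
(* The contradiction [F] is built from a variable other than [p], as the rule for [Ex p] demands. *)
rewrite inE => qp; pose F := Neg (Or (Var q) (Neg (Var q))).
have hF : L (Imp (Ex p (Neg a)) F).
  apply: npqml_ex => //; first by apply: taut_mp ha _; taut.
  by rewrite /= !inE eq_sym (negPf qp).
have := npqml_inst hL p (Neg a) b => /= hi.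
by apply: taut_mp2 hF hi _; taut.
Qed.

Lemma box_K a b : L (Imp (Box (Imp a b)) (Imp (Box a) (Box b))).
Proof.
(* The axiom speaks of variables, which are replaced in turn; [q] is not free in [a], so the second
   replacement leaves the first intact. *)
have [q] := exists_fresh (0 :: fv a); rewrite inE negb_or => /andP[q0 qa].
have /(subst1_closed 0 a) /(subst1_closed q b) /= := npqml_K hL 0 q.
by rewrite (negPf q0) /= eqxx !subst1_fresh.
Qed.

Lemma dia_dual a : L (Iff (Dia a) (Neg (Box (Neg a)))).
Proof. exact: (subst1_closed 0 a (npqml_dual hL 0)). Qed.

Lemma box_mono a b : L (Imp a b) -> L (Imp (Box a) (Box b)).
Proof. by move/(npqml_nec hL)/(npqml_mp hL); apply; apply: box_K. Qed.

Lemma dia_mono a b : L (Imp a b) -> L (Imp (Dia a) (Dia b)).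
Proof.
move=> h; have /box_mono hB : L (Imp (Neg b) (Neg a)).
  by apply: taut_mp h _; taut.
by apply: taut_mp3 hB (dia_dual a) (dia_dual b) _; taut.
Qed.

(** This decides a formula inside a diamond, as needed when a successor is built. *)
Lemma dia_split a b :
  L (Imp (Dia a) (Or (Dia (And a b)) (Dia (And a (Neg b))))).
Proof.
have h : L (Imp (Box (Neg (And a b)))
    (Imp (Box (Neg (And a (Neg b)))) (Box (Neg a)))).
  have /box_mono h :
      L (Imp (Neg (And a b)) (Imp (Neg (And a (Neg b))) (Neg a))).
    by apply: (npqml_taut hL); taut.
  by apply: taut_mp2 h (box_K (Neg (And a (Neg b))) (Neg a)) _; taut.
have d1 := dia_dual (And a b); have d2 := dia_dual (And a (Neg b)).
by apply: taut_mp4 h (dia_dual a) d1 d2 _; taut.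
Qed.

Lemma imp_ex_self p a : L (Imp a (Ex p a)).
Proof.
by rewrite -{1}(subst1_self p a); apply: npqml_inst.
Qed.

Lemma ex_mono p a b : L (Imp a b) -> L (Imp (Ex p a) (Ex p b)).
Proof.
move=> h; apply: (npqml_ex hL); last by rewrite /= mem_filter eqxx.
by apply: taut_mp2 h (imp_ex_self p b) _; taut.
Qed.

(* Stated up to provable equivalence because the two sides may choose
   different bound variables. *)
Lemma subst_comp a s t :
  L (Iff (subst t (subst s a)) (subst (fun r => subst t (s r)) a)).
Proof.
elim: a s t => [p|b ih|b ihb c ihc|b ih|p b ih] s t /=.
- by apply: (npqml_taut hL); taut.
- by apply: taut_mp (ih s t) _; taut.
- by apply: taut_mp2 (ihb s t) (ihc s t) _; taut.
- have h := ih s t; apply: iff_intro; apply: dia_mono.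
    exact: iff_impl.
  exact: iff_impr.
set q := subst_binder s p b.
set u := fun x => subst t (s x).
set r := subst_binder t q _; set m := subst_binder u p b.
have body : L (Iff
    (subst [eta t with q |-> Var r] (subst [eta s with p |-> Var q] b))
    (subst [eta u with p |-> Var r] b)).
  have := ih [eta s with p |-> Var q] [eta t with q |-> Var r].
  rewrite (_ : subst (fun x => subst _ _) b =
    subst [eta u with p |-> Var r] b) //.
  apply: eq_subst => x xb /=; case: eqP => [_ /=|/eqP xp].
    by rewrite eqxx.
  apply: eq_subst => y ys /=; case: eqP => // yq.
  have xF : x \in fv (Ex p b) by rewrite /= mem_filter xp.
  by have := subst_binder_fresh s xF; rewrite -/q -yq ys.
(* Change of bound variable: putting [r1] for [r2] in the instance axiom gives the body at [r1] as
   antecedent, and [r1] is not free in the conclusion unless it equals [r2], where it is bound. *)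
have alpha r1 r2 : (forall x, x \in fv (Ex p b) -> r1 \notin fv (u x)) ->
    (forall x, x \in fv (Ex p b) -> r2 \notin fv (u x)) ->
    L (Imp (Ex r1 (subst [eta u with p |-> Var r1] b))
           (Ex r2 (subst [eta u with p |-> Var r2] b))).
  move=> f1 f2; apply: (npqml_ex hL).
    have := npqml_inst hL r2 (subst [eta u with p |-> Var r2] b) (Var r1).
    have := ih [eta u with p |-> Var r2] [eta Var with r2 |-> Var r1].
    rewrite (_ : subst (fun x => subst _ _) b =
      subst [eta u with p |-> Var r1] b).
      by move=> h1 h2; apply: taut_mp2 h1 h2 _; taut.
    apply: eq_subst => x xb /=; case: eqP => [_ /=|/eqP xp].
      by rewrite eqxx.
    by rewrite subst1_fresh //; apply: f2; rewrite /= mem_filter xp.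
  rewrite /= mem_filter; apply/negP => /andP[r12 /fv_substP[x xb /=]].
  case: eqP => [_|/eqP xp]; first by rewrite inE (negPf r12).
  by apply/negP/f1; rewrite /= mem_filter xp.
have mF x : x \in fv (Ex p b) -> m \notin fv (u x) by apply: subst_binder_fresh.
have rF x : x \in fv (Ex p b) -> r \notin fv (u x).
  move=> xF; apply/negP => /fv_substP[y ys]; apply/negP/subst_binder_fresh.
  rewrite /= mem_filter; apply/andP; split.
    by apply: contraNneq (subst_binder_fresh s xF) => yq; rewrite -/q -yq.
  move: xF; rewrite /= mem_filter => /andP[xp xb].
  by apply/fv_substP; exists x => //=; rewrite (negPf xp).
have h1 := ex_mono r (iff_impl body).
have h2 := ex_mono r (iff_impr body).
apply: iff_intro.
  by apply: taut_mp2 h1 (alpha r m rF mF) _; taut.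
by apply: taut_mp2 h2 (alpha m r mF rF) _; taut.
Qed.

Lemma subst_step p b s a :
  L (subst s a) -> L (subst (fun r => subst [eta Var with p |-> b] (s r)) a).
Proof.
by move/(subst1_closed p b)/(npqml_mp hL); apply; apply/iff_impl/subst_comp.
Qed.

(** As [q] is free in no [s x], replacing it affects only the place of [p] in the composed
    substitution. *)
Lemma subst_rebind p q s a c :
  (forall x, x \in fv (Ex p a) -> q \notin fv (s x)) ->
  L (Iff
    (subst [eta Var with q |-> c] (subst [eta s with p |-> Var q] a))
    (subst [eta s with p |-> c] a)).
Proof.
move=> qs; have := subst_comp a [eta s with p |-> Var q] [eta Var with q |-> c].
rewrite (_ : subst (fun x => subst _ _) a = subst [eta s with p |-> c] a) //.
apply: eq_subst => x xa /=; case: eqP => [_ /=|/eqP xp].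
  by rewrite eqxx.
by rewrite subst1_fresh //; apply: qs; rewrite /= mem_filter xp.
Qed.

Lemma subst1_rebind p q a c : q \notin fv (Ex p a) ->
  L (Iff
    (subst [eta Var with q |-> c] (subst [eta Var with p |-> Var q] a))
    (subst [eta Var with p |-> c] a)).
Proof.
move=> qa; apply: subst_rebind => x xa.
by rewrite inE; apply: contraNneq qa => ->.
Qed.

(* The free variables are first moved, one at a time, beyond everything that
   occurs in the substituted formulas; then they can be replaced one at a time
   without interference. *)
Lemma subst_closed s a : L a -> L (subst s a).
Proof.
move=> ha.
pose N := (\max_(r <- fv a) r).+1.
pose M := maxn N (\max_(x <- flatten [seq fv (s r) | r <- fv a]) x).+1.
have ltN r : r \in fv a -> r < N.
  by move=> ra; rewrite ltnS (@leq_bigmax_seq _ _ xpredT (fun i : nat => i)).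
have ltM r x : r \in fv a -> x \in fv (s r) -> x < M.
  move=> ra xr; rewrite leq_max; apply/orP; right.
  rewrite ltnS (@leq_bigmax_seq _ _ xpredT (fun i : nat => i)) //.
  by apply/flatten_mapP; exists r.
(* Variables below [k] are already shifted by [M]. Since [N <= M], no shifted variable is among
   those still to be moved. *)
have up k : k <= N -> L (subst (fun r => Var (if r < k then M + r else r)) a).
  elim: k => [_|k ih kN].
    by rewrite (_ : subst _ a = a) //; apply: subst_id.
  have := subst_step k (Var (M + k)) (ih (ltnW kN)).
  rewrite (_ : subst (fun r => subst _ _) a =
    subst (fun r => Var (if r < k.+1 then M + r else r)) a) //.
  apply: eq_subst => r ra /=; rewrite ltnS.
  case: (ltngtP r k) => [rk|rk|->] /=; last by rewrite eqxx.
    case: eqP => // /eqP; rewrite eqn_leq => /andP[+ _].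
    by rewrite leqNgt (leq_trans kN (leq_trans (leq_maxl _ _) (leq_addr _ _))).
  by case: eqP rk => // ->; rewrite ltnn.
(* The formulas [s r] already inserted have free variables below [M], so replacing [M + k] does not
   disturb them. *)
have down k : L (subst (fun r => if r < k then s r else Var (M + r)) a).
  elim: k => [|k ih].
    have := up N (leqnn N).
    rewrite (_ : subst _ a = subst (fun r => Var (M + r)) a) //.
    by apply: eq_subst => r /ltN ->.
  have := subst_step (M + k) (s k) ih.
  rewrite (_ : subst (fun r => subst _ _) a =
    subst (fun r => if r < k.+1 then s r else Var (M + r)) a) //.
  apply: eq_subst => r ra /=; rewrite ltnS.
  case: (ltngtP r k) => [rk|rk|->] /=; last by rewrite eqxx.
    rewrite subst1_fresh //; apply/negP => /(ltM _ _ ra).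
    by rewrite ltnNge leq_addr.
  by rewrite eqn_add2l; case: eqP rk => // ->; rewrite ltnn.
have := down N; rewrite (_ : subst _ a = subst s a) //.
by apply: eq_subst => r /ltN ->.
Qed.

(** * Henkin formulas *)

Definition henkin p q a := Imp (Ex p a) (subst [eta Var with p |-> Var q] a).

Lemma subst_henkin p q a c : q \notin fv (Ex p a) ->
  L (Iff (subst [eta Var with q |-> c] (henkin p q a))
         (Imp (Ex p a) (subst [eta Var with p |-> c] a))).
Proof.
move=> qa; set t := [eta Var with q |-> c].
have -> : subst t (henkin p q a) =
    Imp (Ex p a) (subst t (subst [eta Var with p |-> Var q] a)).
  by rewrite -[X in _ = Imp X _](subst1_fresh c qa).
have h := subst1_rebind c qa.
by apply: taut_mp h _; taut.
Qed.

(** If [Ex p a] holds, renaming its bound variable to [q] gives a witness; if it fails, the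
    implication is vacuous and any value of [q] will do. *)
Lemma ex_henkin p q a : q \notin fv (Ex p a) -> L (Ex q (henkin p q a)).
Proof.
move=> qa; set b := subst [eta Var with p |-> Var q] a.
have h1 : L (Imp (Ex p a) (Ex q b)).
  apply: (npqml_ex hL).
    have h2 := npqml_inst hL q b (Var p).
    have h3 := subst1_rebind (Var p) qa; rewrite subst1_self in h3.
    by apply: taut_mp2 h2 h3 _; taut.
  rewrite /= mem_filter; apply/negP => /andP[pq /fv_substP[x xa /=]].
  case: eqP => [_|/eqP xp]; first by rewrite inE (negPf pq).
  by rewrite inE eq_sym (negPf xp).
have h2 : L (Imp (Ex q b) (Ex q (henkin p q a))).
  by apply: ex_mono; apply: (npqml_taut hL); rewrite /henkin -/b; taut.
have := imp_ex_self q (henkin p q a) => h3.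
by apply: taut_mp3 h1 h2 h3 _; rewrite /henkin -/b; taut.
Qed.

(** * Saturated sets and the Lindenbaum lemma *)

(** Witnesses are arbitrary formulas, not variables: this matches quantification over all definable
    sets and lets worlds be built without new variables. *)
Record saturated (T : set form) : Prop := {
  sat_thm : L `<=` T;
  sat_mp : forall a b, T a -> T (Imp a b) -> T b;
  sat_neg : forall a, T (Neg a) <-> ~ T a;
  sat_ex : forall p a, T (Ex p a) ->
    exists c, T (subst [eta Var with p |-> c] a)
}.

(** An abstract notion of a formula compatible with given data, so that one construction yields both
    the successors of a world and the initial world. *)
Record consistency_property (C : set form) : Prop := {
  cp_mono : forall a b, L (Imp a b) -> C a -> C b;
  cp_consistent : forall a, C a -> ~ L (Neg a);
  cp_split : forall a b, C a -> C (And a b) \/ C (And a (Neg b));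
  cp_henkin : forall a p b, C a ->
    exists c, C (And a (Imp (Ex p b) (subst [eta Var with p |-> c] b)))
}.

(** Each stage is a single formula of [C] that implies the previous one, decides the next formula of
    the enumeration and, if that one is existential, implies a Henkin formula for it. The
    consequences of all stages form [T], which stays inside [C] because [C] is closed under provable
    implication. *)
Lemma lindenbaum C a : consistency_property C -> C a ->
  exists T, [/\ saturated T, T a & T `<=` C].
Proof.
move=> hC Ca; have [e eP] := ex_form_enumeration.
have /choice[g gP] : forall x : nat * form, exists g, C x.2 ->
    [/\ C g, L (Imp g x.2),
      L (Imp g (e x.1)) \/ L (Imp g (Neg (e x.1)))
    & forall p b, e x.1 = Ex p b -> exists c,
        L (Imp g (Imp (Ex p b) (subst [eta Var with p |-> c] b)))].
  move=> [n f] /=.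
  (* Outside [C] the value of [g] is a dummy. *)
  have [Cf|nCf] := pselect (C f); last by exists f.
  have [g1 [C1 i1 d1]] : exists g1, [/\ C g1, L (Imp g1 f)
      & L (Imp g1 (e n)) \/ L (Imp g1 (Neg (e n)))].
    have [h|h] := cp_split hC (e n) Cf; eexists; (split; first exact: h).
    - by apply: (npqml_taut hL); taut.
    - by left; apply: (npqml_taut hL); taut.
    - by apply: (npqml_taut hL); taut.
    - by right; apply: (npqml_taut hL); taut.
  have [[p [b E]]|nE] := pselect (exists p b, e n = Ex p b); last first.
    by exists g1 => _; split=> // p b E; case: nE; exists p, b.
  have [c Cc] := cp_henkin hC p b C1.
  eexists => _; split; first exact: Cc.
  - by apply: taut_mp i1 _; taut.
  - by case: d1 => d1; [left|right]; apply: taut_mp d1 _; taut.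
  - rewrite E => _ _ [<- <-]; exists c.
    by apply: (npqml_taut hL); taut.
pose f := fix f n := if n is m.+1 then g (m, f m) else a.
have Cf n : C (f n) by elim: n => //= n ih; case: (gP (n, f n) ih).
have fS n : [/\ L (Imp (f n.+1) (f n)),
      L (Imp (f n.+1) (e n)) \/ L (Imp (f n.+1) (Neg (e n)))
    & forall p b, e n = Ex p b -> exists c,
        L (Imp (f n.+1) (Imp (Ex p b) (subst [eta Var with p |-> c] b)))].
  by case: (gP (n, f n) (Cf n)).
have fD m n : L (Imp (f (m + n)) (f n)).
  elim: m => [|m ih]; first by apply: (npqml_taut hL); taut.
  by have [h _ _] := fS (m + n); apply: taut_mp2 h ih _; taut.
pose T := [set b | exists n, L (Imp (f n) b)].
(* The stages form a chain, so two members of [T] follow from a common stage. *)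
have T2 x b c : L (Imp (f x) b) -> T c ->
    exists n, L (Imp (f n) b) /\ L (Imp (f n) c).
  move=> hb [n hc]; exists (x + n); split; last first.
    by apply: taut_mp2 (fD x n) hc _; taut.
  by rewrite addnC; apply: taut_mp2 (fD n x) hb _; taut.
have Tmp b c : T b -> T (Imp b c) -> T c.
  move=> [x hb] /(T2 _ _ _ hb)[n [h1 h2]]; exists n.
  by apply: taut_mp2 h1 h2 _; taut.
exists T; split; last 1 first.
- by move=> b [n h]; exact: (cp_mono hC h (Cf n)).
- split=> //.
  + by move=> b hb; exists 0; apply: taut_mp hb _; taut.
  + move=> b; split=> [[x hb] /(T2 _ _ _ hb)[n [h1 h2]]|nb].
      apply: (cp_consistent hC (Cf n)).
      by apply: taut_mp2 h1 h2 _; taut.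
    have [n en] := eP b; have [_ [h|h] _] := fS n; last first.
      by exists n.+1; rewrite -en.
    by case: nb; exists n.+1; rewrite -en.
  + move=> p b Tb; have [n en] := eP (Ex p b).
    have [_ _ /(_ _ _ en)[c hc]] := fS n.
    by exists c; apply: Tmp Tb _; exists n.+1.
- by exists 0; apply: (npqml_taut hL); taut.
Qed.

Lemma sat_imp T a b : saturated T -> L (Imp a b) -> T a -> T b.
Proof. by move=> sT /(sat_thm sT) h Ta; exact: (sat_mp sT Ta h). Qed.

Lemma sat_or T a b : saturated T -> T (Or a b) <-> T a \/ T b.
Proof.
move=> sT; split=> [Tab|[h|h]]; last 2 first.
- by apply: sat_imp sT _ h; apply: (npqml_taut hL); taut.
- by apply: sat_imp sT _ h; apply: (npqml_taut hL); taut.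
have [Ta|/(sat_neg sT) nTa] := pselect (T a); [by left|right].
apply: (sat_mp sT nTa); apply: sat_imp sT _ Tab.
by apply: (npqml_taut hL); taut.
Qed.

(** * The canonical frame and the Barcan scheme *)

Context (hBc : forall (p : pvar) (a : form), L (barcan p a)).

(** As [q] is not free in [a], this conjunct can be moved under the quantifier of [ex_henkin]. *)
Lemma ex_henkin_and a p b q : q \notin fv a -> q \notin fv (Ex p b) ->
  L (Imp a (Ex q (And a (henkin p q b)))).
Proof.
move=> qa qb; set D := Ex q _.
have h : L (Imp (Ex q (henkin p q b)) (Imp a D)).
  apply: (npqml_ex hL).
    have h := imp_ex_self q (And a (henkin p q b)).
    by apply: taut_mp h _; rewrite -/D; taut.
  by rewrite /= mem_cat negb_or qa mem_filter eqxx.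
by apply: taut_mp2 h (ex_henkin qb) _; taut.
Qed.

Lemma dia_consistency_property T :
  saturated T -> consistency_property [set a | T (Dia a)].
Proof.
move=> sT; split=> /=.
- by move=> a b /dia_mono; apply: sat_imp.
- move=> a Ta /(npqml_nec hL) /(sat_thm sT) Tb.
  have := sat_imp sT (iff_impl (dia_dual a)) Ta.
  by move/(sat_neg sT).
- by move=> a b /(sat_imp sT (dia_split a b)) /(sat_or _ _ sT).
- move=> a p b Ta; have [q] := exists_fresh (fv a ++ fv (Ex p b)).
  rewrite mem_cat negb_or => /andP[qa qb].
  have := sat_imp sT (dia_mono (ex_henkin_and qa qb)) Ta.
  (* The Barcan scheme brings [Ex q] in front of the diamond, where saturation of [T] supplies [c].
     Putting [c] for [q] fixes [a] and makes [c] the witness in the Henkin formula. *)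
  move/(sat_imp sT (hBc _ _)) /(sat_ex sT) => [c Tc]; exists c.
  move: Tc; set t := [eta Var with q |-> c].
  rewrite -[subst t _]/(Dia (And (subst t a) (subst t (henkin p q b)))).
  rewrite (subst1_fresh c) //; apply: sat_imp => //; apply: dia_mono.
  by apply: taut_mp (subst_henkin c qb) _; taut.
Qed.

Definition cworld := {T : set form | saturated T}.

Definition cacc (w u : cworld) : Prop := forall a, sval u a -> sval w (Dia a).

Definition extent (a : form) : set cworld := [set w | sval w a].

Lemma ext_neg a : extent (Neg a) = ~` extent a.
Proof.
by apply/seteqP; split=> -[T sT] /=; rewrite /extent /= => /(sat_neg sT).
Qed.

Lemma ext_or a b : extent (Or a b) = extent a `|` extent b.
Proof. by apply/seteqP; split=> -[T sT] /(sat_or _ _ sT). Qed.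

(** For the existence of a successor, the set [U] from [lindenbaum] lies among the formulas whose
    diamond is in [T], which is exactly accessibility. *)
Lemma ext_dia a : extent (Dia a) = m_dia cacc (extent a).
Proof.
apply/seteqP; split=> -[T sT] => [Ta|[u ua]]; last exact.
have [U [sU Ua UT]] := lindenbaum (dia_consistency_property sT) Ta.
by exists (exist _ U sU).
Qed.

(** The definition is transparent because later statements use that its admissible sets are the
    extents. *)
Definition canonical_frame (w : cworld) : general_frame.
Proof.
apply: (@GeneralFrame cworld cacc (range extent) (inhabits w)).
- by exists (extent Top), Top.
- by move=> _ [a _ <-]; exists (Neg a) => //; rewrite ext_neg.
- by move=> _ _ [a _ <-] [b _ <-]; exists (Or a b) => //; rewrite ext_or.
- by move=> _ [a _ <-]; exists (Dia a) => //; rewrite ext_dia.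
Defined.

(** The substitution is general because the quantifier case replaces the value at [p] by the extent
    of some formula [c], which means sending [p] to [c]. *)
Lemma truth_lemma (w : cworld) a s
    (v : pvar -> set (world (canonical_frame w))) :
  (forall p, v p = extent (s p)) -> sem v a = extent (subst s a).
Proof.
elim: a s v => [p|b ih|b ihb c ihc|b ih|p b ih] s v sv.
- exact: sv.
- by rewrite [LHS]/= (ih s) // -ext_neg.
- by rewrite [LHS]/= (ihb s) // (ihc s) // -ext_or.
- by rewrite [LHS]/= (ih s) // -ext_dia.
have -> : sem v (Ex p b) = \bigcup_c extent (subst [eta s with p |-> c] b).
  rewrite /= bigcup_image; apply: eq_bigcupr => c _.
  by apply: ih => r /=; case: eqP.
rewrite [subst s _]/=; set q := subst_binder s p b.
have qs x : x \in fv (Ex p b) -> q \notin fv (s x).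
  exact: subst_binder_fresh.
apply/seteqP; split=> -[T sT].
  move=> [c _ Tc]; apply: (sat_imp sT (npqml_inst hL _ _ c)).
  exact: (sat_imp sT (iff_impr (subst_rebind c qs))).
move=> /(sat_ex sT)[c Tc]; exists c => //.
exact: (sat_imp sT (iff_impl (subst_rebind c qs))).
Qed.

Lemma valuation_ext (w : cworld) (v : pvar -> set (world (canonical_frame w))) :
  valuation v -> exists s, forall p, v p = extent (s p).
Proof.
move=> hv; have /choice[s hs] : forall p, exists a, v p = extent a.
  by move=> p; have [a _ <-] := hv p; exists a.
by exists s.
Qed.

Lemma canonical_quantifiable w : quantifiable (canonical_frame w).
Proof.
by move=> a v /valuation_ext[s /(truth_lemma a) ->]; exists (subst s a).
Qed.

Lemma canonical_valid w a : L a -> valid (canonical_frame w) a.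
Proof.
move=> /subst_closed La v /valuation_ext[s /(truth_lemma a) ->].
by apply/seteqP; split=> // -[T sT] _; apply: (sat_thm sT).
Qed.

(** * A saturated set for a given consistent set *)

Definition even_var (r : pvar) : form := Var r.*2.

Lemma bigAnd_cat A B : L (Imp (bigAnd (A ++ B)) (And (bigAnd A) (bigAnd B))).
Proof.
elim: A => [|a A ih] /=; last by apply: taut_mp ih _; taut.
by apply: (npqml_taut hL); rewrite /Top; taut.
Qed.

(* The witnesses are odd variables, which are not free in [subst even_var A]. *)
Lemma even_var_consistency_property (G : set form) :
  consistency_property [set f | ~ exists A : seq form, [set` A] `<=` G /\
    L (Imp f (Neg (subst even_var (bigAnd A))))].
Proof.
split=> /=.
- move=> a b ab nA [A [AG h]]; apply: nA; exists A; split=> //.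
  by apply: taut_mp2 ab h _; taut.
- move=> a nA h; apply: nA; exists [::]; split=> //.
  by apply: taut_mp h _; taut.
- move=> a b nA; apply: contrapT.
  move=> /not_orP[/contrapT[A [AG hA]] /contrapT[B [BG hB]]].
  apply: nA; exists (A ++ B); split.
    by move=> x; rewrite /= mem_cat => /orP[/AG|/BG].
  have hAB := subst_closed even_var (bigAnd_cat A B).
  by apply: taut_mp3 hA hB hAB _ => /=; taut.
- move=> a p b nA.
  (* With [m] the largest free variable, [2m + 1] is both odd and above [m]. *)
  pose q := (\max_(r <- fv a ++ fv (Ex p b)) r).*2.+1.
  have : q \notin fv a ++ fv (Ex p b).
    apply/negP => /(@leq_bigmax_seq _ _ xpredT (fun i : nat => i))/(_ isT).
    by rewrite leqNgt /q ltnS -addnn leq_addr.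
  rewrite mem_cat negb_or => /andP[qa qb].
  exists (Var q) => -[A [AG h]]; apply: nA; exists A; split=> //.
  have qA : q \notin fv (Neg (subst even_var (bigAnd A))).
    apply/negP => /fv_substP[r _]; rewrite inE => /eqP qr.
    by have := congr1 odd qr; rewrite /q /= !odd_double.
  by apply: taut_mp2 (ex_henkin_and qa qb) (npqml_ex hL h qA) _; taut.
Qed.

Lemma consistent_even_var G : consistent L G ->
  exists2 T, saturated T & forall a, G a -> T (subst even_var a).
Proof.
move=> hG; have := even_var_consistency_property G.
set C := (X in consistency_property X) => hC.
have CT : C Top.
  move=> [A [AG h]]; apply: hG; exists A; split=> //.
  have {}h : L (subst even_var (Neg (bigAnd A))).
    by apply: taut_mp h _; rewrite /Top; taut.
  (* Halving undoes the renaming and contradicts the consistency of [G]. *)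
  have := subst_closed (fun r => Var r./2) h.
  move/(npqml_mp hL)/(_ (iff_impl (subst_comp _ _ _))).
  by rewrite subst_id // => r _ /=; rewrite doubleK.
have [T [sT _ TC]] := lindenbaum hC CT.
(* The negation of a renamed member of [G] cannot be in [C], by the one-element list. *)
exists T => // a Ga; apply: contrapT => /(sat_neg sT)/TC; apply.
exists [:: a]; split; first by move=> x /=; rewrite inE => /eqP ->.
by apply: (npqml_taut hL); rewrite /=; taut.
Qed.

End Logic.

Theorem theorem3p1 (L : set form) (hL : NPQML L)
    (hBc : forall (p : pvar) (a : form), L (barcan p a))
    (G : set form) (hG : consistent L G) :
  exists F : general_frame,
    [/\ quantifiable F,
        forall a : form, L a -> valid F a
      & exists (v : pvar -> set (world F)) (w : world F),
          valuation v /\ forall a : form, G a -> sem v a w].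
Proof.
have [T sT GT] := consistent_even_var hL hG.
pose w : cworld L := exist _ T sT.
exists (canonical_frame hL hBc w); split.
- exact: canonical_quantifiable.
- by move=> a; apply: canonical_valid.
exists (fun p => @extent L (even_var p)), w; split=> [p|a /GT Ta].
  by exists (even_var p).
by rewrite (truth_lemma a (s := even_var)).
Qed.
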